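(* Let $k\ge2$ and let $f(q)=\frac{r(q)}{s(q)}$ be a rational function with $r,s\in\mathbb{C}[q]$ coprime and $s(0)\neq0$. Then $f$ is complete Hadamard if and only if all roots of $s(q)$ are roots of unity.
   Context: For $k\ge2$, an analytic function $f\in\mathbb{C}[[q]]$ (a power series converging near $0$) is called $k$-Mahler if there exist $d\ge0$ and polynomials $A,A_0,\dots,A_d\in\mathbb{C}[q]$ with $A_0A_d\neq0$ and $A(q)+A_0(q)f(q)+A_1(q)f(q^k)+\dots+A_d(q)f(q^{k^d})=0$. The Hadamard product of $f=\sum c_nq^n$ and $g=\sum d_nq^n$ is $f\star g=\sum c_nd_nq^n$. A function $f\in\mathbb{C}[[q]]$ is called complete Hadamard if the Hadamard product of $f$ with every $k$-Mahler function is $k$-Mahler ($k$ is fixed throughout). *)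

(* Defs.v *)
From HB Require Import structures.
From mathcomp Require Import all_boot all_order all_algebra.
From mathcomp Require Import complex.
From mathcomp Require Import all_classical all_reals all_analysis.
Set Implicit Arguments.
Unset Strict Implicit.
Unset Printing Implicit Defensive.
Import Order.TTheory GRing.Theory Num.Theory.
Import numFieldNormedType.Exports.
Local Open Scope classical_set_scope.
Local Open Scope ring_scope.

(* A power series over [C] is its coefficient sequence [nat -> C]; equalities
   between power series are stated coefficientwise. *)

Definition fps_of_poly (C : numFieldType) (p : {poly C}) : nat -> C :=
  fun n => p`_n.

Definition fps_mul (C : numFieldType) (a b : nat -> C) : nat -> C :=
  fun n => \sum_(i < n.+1) a i * b (n - i)%N.

(* [f(q^m)], for [0 < m]. *)
Definition fps_subst_pow (C : numFieldType) (m : nat) (f : nat -> C) : nat -> C :=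
  fun n => if (m %| n)%N then f (n %/ m)%N else 0.

Definition hadamard (C : numFieldType) (f g : nat -> C) : nat -> C :=
  fun n => f n * g n.

Definition converges_near0 (C : numFieldType) (f : nat -> C) : Prop :=
  \forall z \near (0 : C), cvgn (series (fun n => f n * z ^+ n)).

(* Only the values [B 0], ..., [B d] of the family [B] matter. *)
Definition mahler (C : numFieldType) (k : nat) (f : nat -> C) : Prop :=
  converges_near0 f /\
  exists (d : nat) (A : {poly C}) (B : nat -> {poly C}),
    B 0%N * B d != 0 /\
    forall n : nat,
      fps_of_poly A n
      + \sum_(i < d.+1)
          fps_mul (fps_of_poly (B i)) (fps_subst_pow (k ^ i)%N f) n = 0.

Definition complete_hadamard (C : numFieldType) (k : nat) (f : nat -> C) : Prop :=
  forall g : nat -> C, mahler k g -> mahler k (hadamard f g).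

(* [f] is the expansion at [0] of [r / s], i.e. [s f = r] as power series; this
   determines [f] when [s(0) <> 0]. *)
Definition expansion_of (C : numFieldType) (r s : {poly C}) (f : nat -> C) : Prop :=
  forall n : nat, fps_mul (fps_of_poly s) f n = fps_of_poly r n.

(* Main.v *)
Require Import Defs.
From HB Require Import structures.
From mathcomp Require Import all_boot all_order all_algebra.
From mathcomp Require Import cyclic separable cyclotomic.
From mathcomp Require Import complex ring zify.
From mathcomp Require Import all_classical all_reals all_analysis.
Set Implicit Arguments.
Unset Strict Implicit.
Unset Printing Implicit Defensive.
Import Order.TTheory GRing.Theory Num.Theory.
Import numFieldNormedType.Exports.
Local Open Scope ring_scope.
Local Open Scope complex_scope.

(** Write [sigma f] for [f(q^k)].  Everything rests on a flexible description
    of Mahler functions ([mahlerP]): a convergent [f] is Mahler exactly when it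
    is a [C(q)]-linear combination of finitely many series [H_a], each of which
    is a [C(q)]-linear combination of the [sigma H_b].  A Mahler equation gives
    such a system, made of [1] and the [sigma^i f], because its coefficient
    [A_0] is nonzero.  Conversely, with [m] series [H_a], the [m + 1] series
    [f, sigma f, ..., sigma^m f] all lie in the span of the [m] series
    [sigma^m H_a], so they satisfy a nontrivial linear relation; if the lowest
    coefficient of that relation vanishes, a Cartier operator (extraction of
    the coefficients in a residue class modulo [k]) divides it by [sigma], until
    the lowest coefficient is nonzero ([normalize_relation]).  In terms of
    systems it is easy to see that Mahler functions are stable under sums,
    multiplication by polynomials, [q d/dq], the removal of the constant term
    followed by division by [q], and the substitution [q := w q] for a root of
    unity [w].  Convergence follows along since, over the complex numbers, it
    amounts to a geometric bound on the coefficients.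

    If all roots of [s] are roots of unity, [s] divides a power of [1 - q^N], so
    [f] is a polynomial multiple of some [e_M = (1 - q^N)^-(M+1)].  Since
    [e_(M+1) = e_M + (q d/dq e_M) / ((M+1) N)], the Hadamard product of
    [e_(M+1)] with [g] is that of [e_M] with
    [g + (q d/dq g) / ((M+1) N)]; the Hadamard product of [e_0] with [g] is the
    average of the [g(w q)] over the [N]-th roots of unity [w].  So [e_M] is
    complete Hadamard, and polynomial multiples of a complete Hadamard function
    are complete Hadamard ([complete_hadamard_scale]).

    If [f] is complete Hadamard and [z] is a root of [s], multiplying [f] by
    [s / (q - z)] and subtracting a polynomial leaves a nonzero multiple of
    [1 / (1 - w q)] with [w = z^-1].  So [g(w q)] is Mahler for the Mahler
    function [g] that is the sum of the [q^(k^n)].  Reading its equation at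
    exponents [k^m + j] with [j] fixed and [m] large, where the gaps isolate the
    coefficient of [q^j] in the [A_i], yields one nonzero polynomial vanishing
    at [w^(k^n)] for all large [n].  A polynomial has finitely many roots, so
    [w^(k^a) = w^(k^b)] for some [a < b], and [w] is a root of unity
    ([twist_powers_unity]). *)

(** * Power series as a module over the polynomials *)

(** An alias of [nat -> C], so that scaling by a polynomial can be the
    multiplication of power series. *)
Definition fps (C : numFieldType) : Type := nat -> C.

HB.instance Definition _ (C : numFieldType) := GRing.Zmodule.copy (fps C) (nat -> C).

Section FpsModule.
Variable C : numFieldType.
Implicit Types (p q : {poly C}) (f g : fps C).

Definition fps_scale p f : fps C := fps_mul (fps_of_poly p) f.

Lemma fps_addE f g n : (f + g) n = f n + g n. Proof. by []. Qed.

Lemma fps_oppE f n : (- f) n = - f n. Proof. by []. Qed.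

Lemma fps_sumE (I : Type) (s : seq I) (F : I -> fps C) n :
  (\sum_(i <- s) F i) n = \sum_(i <- s) F i n.
Proof. by elim/big_ind2: _ => // [f1 a f2 b <- <-]. Qed.

(** Truncating [f] to a polynomial reduces the module axioms to the ring laws
    of polynomials. *)
Lemma fps_scale_trunc p f N n :
  (n < N)%N -> fps_scale p f n = (p * \poly_(i < N) f i)`_n.
Proof.
move=> nN; rewrite coefM; apply: eq_bigr => i _; rewrite coef_poly.
by rewrite (leq_ltn_trans (leq_subr _ _) nN).
Qed.

Lemma fps_scalerA p q f : fps_scale p (fps_scale q f) = fps_scale (p * q) f.
Proof.
apply/funext => n; rewrite (fps_scale_trunc (p * q) f (ltnSn n)) -mulrA coefM.
apply: eq_bigr => i _.
by rewrite (@fps_scale_trunc q f n.+1) // ltnS leq_subr.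
Qed.

Lemma fps_scale1r : left_id 1 fps_scale.
Proof.
move=> f; apply/funext => n; rewrite (fps_scale_trunc _ _ (ltnSn n)) mul1r.
by rewrite coef_poly ltnSn.
Qed.

Lemma fps_scalerDr : right_distributive fps_scale +%R.
Proof.
move=> p f g; apply/funext => n; rewrite fps_addE -big_split.
by apply: eq_bigr => i _; exact: mulrDr.
Qed.

Lemma fps_scalerDl f : {morph fps_scale^~ f : p q / p + q}.
Proof.
move=> p q; apply/funext => n; rewrite fps_addE -big_split.
by apply: eq_bigr => i _; rewrite {1}/fps_of_poly coefD; exact: mulrDl.
Qed.

HB.instance Definition _ := GRing.Zmodule_isLmodule.Build {poly C} (fps C)
  fps_scalerA fps_scale1r fps_scalerDr fps_scalerDl.

Lemma fps_scaleE p f : p *: f = fps_mul (fps_of_poly p) f. Proof. by []. Qed.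

Lemma fps_scaleC c f n : (c%:P *: f) n = c * f n.
Proof.
rewrite fps_scaleE /fps_mul big_ord_recl big1 ?addr0 ?subn0 /fps_of_poly ?coefC //.
by move=> i _; rewrite coefC mul0r.
Qed.

Lemma fps_scaleX f n : ('X *: f) n = if n is m.+1 then f m else 0.
Proof.
rewrite [LHS](fps_scale_trunc _ _ (ltnSn n)) coefXM.
by case: n => //= n; rewrite coef_poly ltnS leqnSn.
Qed.

Lemma fps_scaleXn i f n : ('X^i *: f) n = if (i <= n)%N then f (n - i)%N else 0.
Proof.
rewrite [LHS](fps_scale_trunc _ _ (ltnSn n)) coefXnM ltnNge if_neg.
by case: ifP => // _; rewrite coef_poly ltnS leq_subr.
Qed.

Definition fps1 : fps C := fps_of_poly 1.

Lemma fps_scale_one p n : (p *: fps1) n = p`_n.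
Proof.
rewrite [LHS](fps_scale_trunc _ _ (ltnSn n)).
have -> : \poly_(i < n.+1) fps1 i = 1; last by rewrite mulr1.
by apply/polyP=> -[|i]; rewrite coef_poly /fps1 /fps_of_poly coef1 //= ; case: ifP.
Qed.

Lemma semilinear_poly (phi : {additive fps C -> fps C})
    (tau : {rmorphism {poly C} -> {poly C}}) :
    (forall c f, phi (c%:P *: f) = tau c%:P *: phi f) ->
    (forall f, phi ('X *: f) = tau 'X *: phi f) ->
  forall p f, phi (p *: f) = tau p *: phi f.
Proof.
move=> hC hX; elim/poly_ind => [|p c IH] f; first by rewrite !scale0r raddf0 rmorph0 scale0r.
by rewrite scalerDl -scalerA raddfD IH hX hC rmorphD rmorphM scalerDl scalerA.
Qed.

End FpsModule.

(** * Linear spans over the field of rational functions *)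

Section Span.
Variable C : numFieldType.
Implicit Types (p q : {poly C}) (f g : fps C).

(** Membership in the [C(q)]-span of the family [H], with the denominators
    cleared: [q] is a common denominator. *)
Definition inspan (T : finType) (H : T -> fps C) (g : fps C) : Prop :=
  exists (q : {poly C}) (c : T -> {poly C}),
    q != 0 /\ q *: g = \sum_a c a *: H a.

Lemma inspan_mem (T : finType) (H : T -> fps C) a : inspan H (H a).
Proof.
exists 1, (fun b => (b == a)%:R); split; first exact: oner_neq0.
rewrite (bigD1 a) //= eqxx scale1r big1 ?addr0 // => b /negPf ->.
by rewrite scale0r.
Qed.

Lemma inspan0 (T : finType) (H : T -> fps C) : inspan H 0.
Proof.
exists 1, (fun=> 0); split; first exact: oner_neq0.
by rewrite scaler0 big1 // => a _; rewrite scale0r.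
Qed.

Lemma inspanZ (T : finType) (H : T -> fps C) p g : inspan H g -> inspan H (p *: g).
Proof.
move=> [q [c [q0 E]]]; exists q, (fun a => p * c a); split=> //.
rewrite scalerA mulrC -scalerA E scaler_sumr.
by apply: eq_bigr => a _; rewrite scalerA.
Qed.

Lemma inspanD (T : finType) (H : T -> fps C) f g :
  inspan H f -> inspan H g -> inspan H (f + g).
Proof.
move=> [q [c [q0 E]]] [q' [c' [q0' E']]].
exists (q * q'), (fun a => q' * c a + q * c' a); split; first exact: mulf_neq0.
rewrite scalerDr -(scalerA q q' g) E' (mulrC q) -scalerA E !scaler_sumr -big_split.
by apply: eq_bigr => a _; rewrite scalerDl !scalerA.
Qed.

Lemma inspan_sum (T : finType) (H : T -> fps C) (I : Type) (s : seq I) (F : I -> fps C) :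
  (forall i, inspan H (F i)) -> inspan H (\sum_(i <- s) F i).
Proof.
by move=> hF; apply: (big_ind (inspan H)) => //; [exact: inspan0 | exact: inspanD].
Qed.

Lemma inspan_cancel (T : finType) (H : T -> fps C) p g :
  p != 0 -> inspan H (p *: g) -> inspan H g.
Proof.
move=> p0 [q [c [q0 E]]]; exists (q * p), c; split; first exact: mulf_neq0.
by rewrite -scalerA.
Qed.

Lemma inspan_common_denominator (S T : finType) (H : T -> fps C) (G : S -> fps C) :
    (forall a, inspan H (G a)) ->
  exists (q : {poly C}) (M : S -> T -> {poly C}),
    q != 0 /\ forall a, q *: G a = \sum_b M a b *: H b.
Proof.
move=> /choice[Q] /choice[c hc].
exists (\prod_a Q a), (fun a b => (\prod_(a' | a' != a) Q a') * c a b).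
split; first by apply/prodf_neq0 => a _; case: (hc a).
move=> a; rewrite (bigD1 a) //= mulrC -scalerA (proj2 (hc a)) scaler_sumr.
by apply: eq_bigr => b _; rewrite scalerA.
Qed.

Lemma inspan_trans (S T : finType) (H : T -> fps C) (G : S -> fps C) g :
  (forall a, inspan H (G a)) -> inspan G g -> inspan H g.
Proof.
move=> hG [q [c [q0 E]]]; apply: (inspan_cancel q0); rewrite E.
by apply: inspan_sum => a; apply: inspanZ.
Qed.

Lemma inspan_semilinear (phi : {additive fps C -> fps C}) (tau : {poly C} -> {poly C})
    (T : finType) (H : T -> fps C) g :
    (forall p f, phi (p *: f) = tau p *: phi f) -> (forall p, p != 0 -> tau p != 0) ->
  inspan H g -> inspan (fun a => phi (H a)) (phi g).
Proof.
move=> hphi htau [q [c [q0 E]]]; exists (tau q), (fun a => tau (c a)); split; first exact: htau.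
by rewrite -hphi E raddf_sum; apply: eq_bigr => a _; rewrite hphi.
Qed.

(** More vectors than generators are dependent.  The coefficient matrix is made
    square by a zero column, so that its determinant vanishes; working with the
    determinant over the domain of polynomials avoids fractions. *)
Lemma inspan_dependent (T : finType) (H : T -> fps C) (G : 'I_#|T|.+1 -> fps C) :
    (forall i, inspan H (G i)) ->
  exists v : 'I_#|T|.+1 -> {poly C}, (exists i, v i != 0) /\ \sum_i v i *: G i = 0.
Proof.
move=> /inspan_common_denominator[q [M [q0 E]]].
pose N : 'M[{poly C}]_#|T|.+1 :=
  \matrix_(i, j) oapp (fun j' => M i (enum_val j')) 0 (unlift ord_max j).
(* The column [ord_max] of [N] is zero. *)
have N0 : \det N = 0.
  rewrite -det_tr; apply/eqP/det0P; exists (delta_mx 0 ord_max).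
    apply/eqP => /matrixP/(_ 0 ord_max)/eqP.
    by rewrite !mxE !eqxx oner_eq0.
  by rewrite -rowE; apply/rowP=> j; rewrite !mxE unlift_none.
have /eqP/det0P[v v0 vN] := N0.
exists (fun i => v 0 i * q); split.
  have [i vi] : exists i, v 0 i != 0.
    apply/existsP; apply: contra_neqT v0 => /existsPn h.
    by apply/rowP=> i; rewrite mxE; apply/eqP; rewrite -[_ == _]negbK h.
  by exists i; rewrite mulf_neq0.
have vM b : \sum_i v 0 i * M i b = 0.
  have /rowP/(_ (lift ord_max (enum_rank b))) := vN; rewrite !mxE => vNb.
  rewrite -[RHS]vNb; apply: eq_bigr => i _.
  by rewrite mxE liftK /= enum_rankK.
transitivity (\sum_i \sum_b (v 0 i * M i b) *: H b).
  by apply: eq_bigr => i _; rewrite -scalerA E scaler_sumr; under eq_bigr do rewrite scalerA.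
by rewrite exchange_big big1 // => b _; rewrite -scaler_suml vM scale0r.
Qed.

End Span.

(** * Operators on power series *)

Section Operators.
Variable C : numFieldType.
Implicit Types (p q : {poly C}) (f g : fps C) (w : C).

Definition dilate (m : nat) : fps C -> fps C := @fps_subst_pow C m.
(** The substitution [q := w q]. *)
Definition twist w f : fps C := fun n => w ^+ n * f n.
(** The derivation [q d/dq]. *)
Definition euler f : fps C := fun n => n%:R * f n.
(** [(f - f(0)) / q]. *)
Definition unshift f : fps C := fun n => f n.+1.

Lemma dilateE m f n : dilate m f n = if (m %| n)%N then f (n %/ m)%N else 0.
Proof. by []. Qed.

Fact dilate_is_additive m : zmod_morphism (dilate m).
Proof.
move=> f g; apply/funext => n; rewrite [RHS]fps_addE.
rewrite fps_oppE !dilateE.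
by case: ifP => _ //; rewrite subr0.
Qed.
HB.instance Definition _ m :=
  GRing.isZmodMorphism.Build (fps C) (fps C) (dilate m) (dilate_is_additive m).

Fact twist_is_additive w : zmod_morphism (twist w).
Proof. by move=> f g; apply/funext => n; exact: mulrBr. Qed.
HB.instance Definition _ w :=
  GRing.isZmodMorphism.Build (fps C) (fps C) (twist w) (twist_is_additive w).

Fact euler_is_additive : zmod_morphism euler.
Proof. by move=> f g; apply/funext => n; exact: mulrBr. Qed.
HB.instance Definition _ :=
  GRing.isZmodMorphism.Build (fps C) (fps C) euler euler_is_additive.

Lemma dilateZ m p f : (0 < m)%N -> dilate m (p *: f) = (p \Po 'X^m) *: dilate m f.
Proof.
move=> m0; move: p f; apply: (@semilinear_poly C (dilate m) (comp_poly 'X^m)) => [c f|f] /=.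
  rewrite comp_polyC; apply/funext => n.
  by rewrite fps_scaleC !dilateE fps_scaleC; case: ifP; rewrite ?mulr0.
rewrite comp_polyX; apply/funext => n; rewrite fps_scaleXn !dilateE fps_scaleX.
case: (leqP m n) => [mn|nm].
  rewrite -{1 2}(subnK mn) dvdn_addl // divnDr // divnn m0 addn1.
  by case: ifP.
case: ifP => // /dvdnP[[|a] E]; first by rewrite E mul0n div0n.
by move: nm; rewrite E ltnNge mulSn leq_addr.
Qed.

Lemma dilateM a b f : (0 < a)%N -> (0 < b)%N -> dilate a (dilate b f) = dilate (a * b) f.
Proof.
move=> a0 b0; apply/funext => n; rewrite !dilateE.
case: (boolP (a %| n)%N) => [/dvdnP[c ->]|an].
  by rewrite mulnK // [(c * a)%N]mulnC dvdn_pmul2l // divnMl.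
by case: ifP => // /(dvdn_trans (dvdn_mulr b (dvdnn a))) an'; rewrite an' in an.
Qed.

Lemma dilate_id f : dilate 1 f = f.
Proof. by apply/funext => n; rewrite dilateE dvd1n divn1. Qed.

Lemma dilate_fps1 m : (0 < m)%N -> dilate m (fps1 C) = fps1 C.
Proof.
move=> m0; apply/funext => n; rewrite dilateE /fps1 /fps_of_poly !coef1.
case: n => [|n]; first by rewrite dvdn0 div0n.
by case: ifP => // h; rewrite eqn0Ngt divn_gt0 // dvdn_leq.
Qed.

Lemma twistZ w p f : twist w (p *: f) = (p \Po (w *: 'X)) *: twist w f.
Proof.
move: p f; apply: (@semilinear_poly C (twist w) (comp_poly (w *: 'X))) => [c f|f] /=;
  rewrite ?comp_polyC ?comp_polyX; apply/funext => n.
  by rewrite /twist !fps_scaleC mulrCA.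
rewrite -mul_polyC -scalerA fps_scaleC /twist !fps_scaleX.
by case: n => [|n]; rewrite ?mulr0 // exprS mulrA.
Qed.

Lemma twist_dilate w m f : twist w (dilate m f) = dilate m (twist (w ^+ m) f).
Proof.
apply/funext => n; rewrite /twist !dilateE; case: ifP => [mn|]; last by rewrite mulr0.
by rewrite -exprM mulnC divnK.
Qed.

Lemma eulerZ p f : euler (p *: f) = ('X * p^`()) *: f + p *: euler f.
Proof.
elim/poly_ind: p f => [|p c IH] f.
  by rewrite deriv0 mulr0 !scale0r raddf0 addr0.
have hC g : euler (c%:P *: g) = c%:P *: euler g.
  by apply/funext => n; rewrite /euler !fps_scaleC mulrCA.
have hX g : euler ('X *: g) = 'X *: g + 'X *: euler g.
  apply/funext => n; rewrite fps_addE /euler !fps_scaleX; case: n => [|n].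
    by rewrite mulr0 addr0.
  by rewrite -natr1 mulrDl mul1r addrC.
rewrite scalerDl raddfD -scalerA /= IH hC hX derivD derivC addr0 derivM derivX mulr1.
by rewrite scalerDr !scalerA mulrDr !scalerDl [p * _]mulrC mulrA !addrA.
Qed.

Lemma euler_dilate m f : (0 < m)%N -> euler (dilate m f) = m%:R%:P *: dilate m (euler f).
Proof.
move=> m0; apply/funext => n; rewrite fps_scaleC /euler !dilateE.
by case: ifP => [mn|]; rewrite ?mulr0 // mulrA -natrM mulnC divnK.
Qed.

Lemma fps_scaleX_unshift f : 'X *: unshift f = f - (f 0%N)%:P *: fps1 C.
Proof.
apply/funext => n; rewrite fps_addE fps_oppE fps_scaleX.
rewrite fps_scale_one coefC; case: n => [|n]; first by rewrite subrr.
by rewrite subr0.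
Qed.

End Operators.

(** * Mahler systems *)

Section MahlerSystems.
Variables (C : numFieldType) (k : nat).
Hypothesis k1 : (1 < k)%N.
Implicit Types (p q : {poly C}) (f g : fps C).
Let k0 : (0 < k)%N. Proof. exact: ltnW. Qed.

Lemma inspan_dilate (T : finType) (H : T -> fps C) m g :
  (0 < m)%N -> inspan H g -> inspan (fun a => dilate m (H a)) (dilate m g).
Proof.
move=> m0; apply: (inspan_semilinear (tau := comp_poly 'X^m)) => [p f|p p0].
  exact: dilateZ.
by rewrite comp_poly_eq0 // size_polyXn ltnS.
Qed.

Lemma inspan_twist (T : finType) (H : T -> fps C) (w : C) g :
  w != 0 -> inspan H g -> inspan (fun a => twist w (H a)) (twist w g).
Proof.
move=> w0; apply: (inspan_semilinear (tau := comp_poly (w *: 'X))) => [p f|p p0].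
  exact: twistZ.
by rewrite comp_poly_eq0 // size_scale // size_polyX.
Qed.

(** The members of [H] are expressed through their images under [f(q) -> f(q^k)],
    so iterating the relations [m] times carries all [dilate (k ^ i)] of the
    members, [i <= m], into the span of the single family
    [dilate (k ^ m) (H a)], whose size is independent of [m]. *)
Definition mahler_system (T : finType) (H : T -> fps C) : Prop :=
  forall a, inspan (fun b => dilate k (H b)) (H a).

Definition in_mahler_system f : Prop :=
  exists (T : finType) (H : T -> fps C), mahler_system H /\ inspan H f.

Lemma mahler_system_iter (T : finType) (H : T -> fps C) L a :
  mahler_system H -> inspan (fun b => dilate (k ^ L) (H b)) (H a).
Proof.
move=> hH; elim: L a => [|L IH] a.
  rewrite (_ : (fun b => _) = H); first exact: inspan_mem.
  by apply/funext => b; rewrite expn0 dilate_id.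
apply: inspan_trans (IH a) => b.
rewrite (_ : (fun c => _) = fun c => dilate (k ^ L) (dilate k (H c))); last first.
  by apply/funext => c; rewrite dilateM ?expn_gt0 ?k0 // expnSr.
by apply: inspan_dilate (hH b); rewrite expn_gt0 k0.
Qed.

(** [#|T| + 1] iterates of [f] lie in the span of the [#|T|] series
    [dilate (k ^ #|T|) (H a)]. *)
Lemma in_mahler_system_relation f : in_mahler_system f ->
  exists (d : nat) (B : nat -> {poly C}),
    (exists2 i, (i <= d)%N & B i != 0) /\ \sum_(i < d.+1) B i *: dilate (k ^ i) f = 0.
Proof.
move=> [T [H [hH hf]]]; pose m := #|T|.
have [|v [[i vi] E]] := @inspan_dependent C T (fun b => dilate (k ^ m) (H b))
    (fun i => dilate (k ^ i) f).
  move=> i; have im : (i <= m)%N by rewrite -ltnS.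
  apply: inspan_trans (inspan_dilate _ hf); last by rewrite expn_gt0 k0.
  move=> a /=; rewrite (_ : (fun c => _) =
      fun c => dilate (k ^ i) (dilate (k ^ (m - i)) (H c))); last first.
    by apply/funext => c; rewrite dilateM ?expn_gt0 ?k0 // -expnD subnKC.
  by apply: inspan_dilate; [rewrite expn_gt0 k0 | exact: mahler_system_iter].
exists m, (fun i => v (inord i)); split.
  by exists i; [rewrite -ltnS | rewrite inord_val].
by rewrite -[RHS]E; apply: eq_bigr => j _; rewrite inord_val.
Qed.

(** The Cartier operator [f -> sum_n f_(kn+r) q^n] turns [p *: dilate k g] into
    a multiple of [g]; comparing the operators for all [r] lets the proof go by
    induction on [p], since multiplication by [q] permutes the residues. *)
Lemma cartier_scale p r : (r < k)%N ->
  exists p', (forall n, p'`_n = p`_(k * n + r)) /\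
    forall g n, (p *: dilate k g) (k * n + r)%N = (p' *: g) n.
Proof.
move=> rk; suff [p' hp'] : exists p', forall g n,
    (p *: dilate k g) (k * n + r)%N = (p' *: g) n.
  exists p'; split=> // n.
  by rewrite -fps_scale_one -hp' dilate_fps1 // fps_scale_one.
elim/poly_ind: p r rk => [|p c IH] [|r] rk.
- by exists 0 => g n; rewrite !scale0r.
- by exists 0 => g n; rewrite !scale0r.
- have [|p' hp'] := IH k.-1; first by rewrite prednK.
  exists ('X * p' + c%:P) => g n.
  rewrite !scalerDl !fps_addE !fps_scaleC addn0 dilateE dvdn_mulr // mulKn //.
  congr (_ + _); rewrite mulrC -!scalerA !fps_scaleX.
  case: n => [|n]; first by rewrite muln0.
  by have -> : (k * n.+1)%N = (k * n + k.-1).+1; [rewrite mulnS addnC -addnS prednK | exact: hp'].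
have [|p' hp'] := IH r; first exact: ltnW.
exists p' => g n.
rewrite scalerDl fps_addE fps_scaleC dilateE dvdn_addr ?dvdn_mulr //.
rewrite [(k %| r.+1)%N]gtnNdvd // mulr0 addr0 mulrC -scalerA fps_scaleX addnS.
exact: hp'.
Qed.

(** Trim the relation from both ends: a zero top coefficient is dropped; a zero
    bottom coefficient allows a Cartier operator to lower all exponents of [k]
    by one, the residue [r] being chosen so that the top coefficient survives. *)
Lemma normalize_relation f d (B : nat -> {poly C}) :
    (exists2 i, (i <= d)%N & B i != 0) -> \sum_(i < d.+1) B i *: dilate (k ^ i) f = 0 ->
  exists (d' : nat) (B' : nat -> {poly C}),
    B' 0%N * B' d' != 0 /\ \sum_(i < d'.+1) B' i *: dilate (k ^ i) f = 0.
Proof.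
elim: d B => [|d IH] B [i id Bi] E.
  by exists 0%N, B; split=> //; move: id Bi; rewrite leqn0 mulf_eq0 orbb => /eqP ->.
have [Bd|Bd] := eqVneq (B d.+1) 0.
  apply: (IH B); last by move: E; rewrite big_ord_recr /= Bd scale0r addr0.
  exists i => //; move: id; rewrite leq_eqVlt => /orP[/eqP ei|//].
  by rewrite ei Bd eqxx in Bi.
have [B0|B0] := eqVneq (B 0%N) 0; last first.
  by exists d.+1, B; split=> //; rewrite mulf_neq0.
pose j := (size (B d.+1)).-1; pose r := (j %% k)%N.
have rk : (r < k)%N by rewrite ltn_mod.
have /choice[B' hB'] := fun i => @cartier_scale (B i.+1) r rk.
apply: (IH B').
  exists d => //; apply: contra_neq Bd => B'd.
  apply/eqP; rewrite -lead_coef_eq0 /lead_coef -/j (divn_eq j k) mulnC.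
  by rewrite -(proj1 (hB' d)) B'd coef0.
apply/funext => n; rewrite fps_sumE.
transitivity ((\sum_(i < d.+2) B i *: dilate (k ^ i) f) (k * n + r)%N); last by rewrite E.
rewrite [in RHS]big_ord_recl [B ord0]B0 scale0r add0r fps_sumE; apply: eq_bigr => a _.
by rewrite -(proj2 (hB' a)) dilateM ?expn_gt0 ?k0 // -expnS.
Qed.

(** The invertibility of the coefficient of [f] itself is what makes
    [1, f, f(q^k), ...] a Mahler system. *)
Lemma mahlerP f : mahler k f <-> converges_near0 f /\ in_mahler_system f.
Proof.
split=> -[cf]; last first.
  move=> /in_mahler_system_relation[d [B [Bi E]]].
  have [d' [B' [B'0 E']]] := normalize_relation Bi E.
  split=> //; exists d', 0, B'; split=> // n.
  have /(congr1 (fun h : fps C => h n)) := E'.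
  by rewrite fps_sumE /fps_of_poly coef0 add0r.
move=> [d [A [B [Bd E]]]]; split=> //.
have {}E : A *: fps1 C + \sum_(i < d.+1) B i *: dilate (k ^ i) f = 0.
  by apply/funext => n; rewrite fps_addE fps_sumE fps_scale_one; exact: E.
have B0 : B 0%N != 0 by move: Bd; rewrite mulf_eq0 negb_or => /andP[].
pose H (o : option 'I_d.+1) : fps C := if o is Some i then dilate (k ^ i) f else fps1 C.
exists (option 'I_d.+1), H; split; last first.
  by have := inspan_mem H (Some ord0); rewrite /= expn0 dilate_id.
have hS (i : nat) : (i < d.+1)%N -> inspan (fun b => dilate k (H b)) (dilate (k ^ i.+1) f).
  move=> id; have := inspan_mem (fun b => dilate k (H b)) (Some (Ordinal id)).
  by rewrite /= dilateM ?expn_gt0 ?k0 // -expnS.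
have h1 : inspan (fun b => dilate k (H b)) (fps1 C).
  by have := inspan_mem (fun b => dilate k (H b)) None; rewrite /= dilate_fps1.
move=> [[[|i] id]|] //=; last first.
  exact/hS/ltnW.
apply: (inspan_cancel B0).
have -> : B 0%N *: dilate (k ^ 0) f =
    (- A) *: fps1 C + \sum_(i < d) (- B i.+1) *: dilate (k ^ i.+1) f.
  apply/eqP; rewrite -subr_eq0 -[X in _ == X]E big_ord_recl scaleNr.
  rewrite opprD opprK -sumrN addrCA.
  by apply/eqP; congr (_ + (_ + _)); apply: eq_bigr => a _; rewrite scaleNr opprK.
apply: inspanD; first exact: inspanZ.
by apply: inspan_sum => a; apply: inspanZ; apply: hS; apply: ltnW; rewrite ltnS.
Qed.

Lemma in_mahler_system_add f g :
  in_mahler_system f -> in_mahler_system g -> in_mahler_system (f + g).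
Proof.
move=> [T [H [hH hf]]] [T' [H' [hH' hg]]].
pose K (t : T + T') := match t with inl a => H a | inr b => H' b end.
have hl a : inspan K (H a) by exact: (inspan_mem K (inl a)).
have hr a : inspan K (H' a) by exact: (inspan_mem K (inr a)).
exists (T + T')%type, K; split; last first.
  by apply: inspanD; [exact: inspan_trans hf | exact: inspan_trans hg].
move=> [a|b] /=.
  by apply: inspan_trans (hH a) => c; exact: (inspan_mem _ (inl c)).
by apply: inspan_trans (hH' b) => c; exact: (inspan_mem _ (inr c)).
Qed.

Lemma in_mahler_system_scale p f : in_mahler_system f -> in_mahler_system (p *: f).
Proof. by move=> [T [H [hH hf]]]; exists T, H; split=> //; exact: inspanZ. Qed.

Lemma in_mahler_system_cancel p f :
  p != 0 -> in_mahler_system (p *: f) -> in_mahler_system f.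
Proof. by move=> p0 [T [H [hH hf]]]; exists T, H; split=> //; exact: inspan_cancel hf. Qed.

Lemma in_mahler_system_one : in_mahler_system (fps1 C).
Proof.
exists unit, (fun=> fps1 C); split; last exact: (inspan_mem _ tt).
by move=> a; rewrite dilate_fps1 //; exact: (inspan_mem _ tt).
Qed.

Lemma in_mahler_system_unshift f : in_mahler_system f -> in_mahler_system (unshift f).
Proof.
move=> hf; apply: (@in_mahler_system_cancel 'X); first by rewrite polyX_eq0.
rewrite fps_scaleX_unshift -scaleNr; apply: in_mahler_system_add => //.
exact/in_mahler_system_scale/in_mahler_system_one.
Qed.

(** Differentiating [q *: g = sum_a c_a *: H_a] by the Leibniz rule gives an
    expression of [q *: euler g]. *)
Lemma inspan_euler (T U : finType) (H : T -> fps C) (K : U -> fps C) g :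
    (forall a, inspan K (H a)) -> (forall a, inspan K (euler (H a))) ->
  inspan H g -> inspan K (euler g).
Proof.
move=> hK hK' hg; have [q [c [q0 E]]] := hg; apply: (inspan_cancel q0).
have -> : q *: euler g = euler (\sum_a c a *: H a) - ('X * q^`()) *: g.
  by rewrite -E eulerZ addrC addKr.
rewrite raddf_sum -scaleNr; apply: inspanD.
  by apply: inspan_sum => a /=; rewrite eulerZ; apply: inspanD; exact: inspanZ.
by apply: inspanZ; exact: inspan_trans hg.
Qed.

Lemma in_mahler_system_euler f : in_mahler_system f -> in_mahler_system (euler f).
Proof.
move=> [T [H [hH hf]]].
pose K (t : T + T) := match t with inl a => H a | inr b => euler (H b) end.
exists (T + T)%type, K; split; last first.
  apply: inspan_euler hf => a; first exact: (inspan_mem K (inl a)).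
  exact: (inspan_mem K (inr a)).
have hl a : inspan (fun b => dilate k (K b)) (dilate k (H a)).
  exact: (inspan_mem _ (inl a)).
move=> [a|a] /=; first exact: inspan_trans (hH a).
apply: inspan_euler (hH a) => // b; rewrite euler_dilate //; apply: inspanZ.
exact: (inspan_mem _ (inr b)).
Qed.

(** The twists of all members by all powers of [w] form one system, because
    moving the twist by [w^t] past [dilate k] turns it into the twist by
    [w^(t k)]. *)
Lemma in_mahler_system_twist N w f : (0 < N)%N -> w ^+ N = 1 ->
  in_mahler_system f -> in_mahler_system (twist w f).
Proof.
case: N => // N _ wN [T [H [hH hf]]].
have w0 : w != 0.
  by apply/eqP => w0; move/eqP: wN; rewrite w0 expr0n eq_sym oner_eq0.
pose K (t : T * 'I_N.+1) := twist (w ^+ t.2) (H t.1).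
exists (T * 'I_N.+1)%type, K; split; last first.
  apply: inspan_trans (inspan_twist w0 hf) => a.
  have := inspan_mem K (a, inord (1 %% N.+1)).
  by rewrite /K /= inordK ?ltn_mod // expr_mod.
move=> [a t]; rewrite /K /=.
apply: inspan_trans (inspan_twist (expf_neq0 t w0) (hH a)) => b.
rewrite twist_dilate.
have := inspan_mem (fun u => dilate k (K u)) (b, inord ((t * k) %% N.+1)).
by rewrite /K /= inordK ?ltn_mod // expr_mod // exprM.
Qed.

End MahlerSystems.

(** * Convergence as a geometric bound *)

Section GeometricBound.
Variable C : numFieldType.
Implicit Types (f g : fps C) (p : {poly C}).

Definition geom_bounded f : Prop :=
  exists K rho : C, 0 < rho /\ forall n, `|f n| <= K * rho ^+ n.

Lemma geom_bounded_ge0 f K rho : (forall n, `|f n| <= K * rho ^+ n) -> 0 <= K.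
Proof. by move=> /(_ 0%N); rewrite expr0 mulr1; apply: le_trans. Qed.

Lemma geom_bounded_add f g : geom_bounded f -> geom_bounded g -> geom_bounded (f + g).
Proof.
move=> [K [x [x0 hf]]] [L [y [y0 hg]]]; exists (K + L), (x + y).
split=> [|n]; first exact: addr_gt0.
rewrite fps_addE (le_trans (ler_normD _ _)) // mulrDl lerD //.
  rewrite (le_trans (hf n)) // ler_wpM2l ?(geom_bounded_ge0 hf) //.
  by rewrite lerXn2r ?nnegrE ?addr_ge0 ?lerDl // ltW.
rewrite (le_trans (hg n)) // ler_wpM2l ?(geom_bounded_ge0 hg) //.
by rewrite lerXn2r ?nnegrE ?addr_ge0 ?lerDr // ltW.
Qed.

Lemma geom_bounded_scale p f : geom_bounded f -> geom_bounded (p *: f).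
Proof.
elim/poly_ind: p f => [|p c IH] f hf.
  by rewrite scale0r; exists 0, 1; split=> // n; rewrite normr0 mul0r.
have [K [x [x0 h]]] := hf; have K0 := geom_bounded_ge0 h.
rewrite scalerDl -scalerA; apply: geom_bounded_add.
  apply: IH; exists (K / x), x; split=> // -[|n]; rewrite fps_scaleX.
    by rewrite normr0 !mulr_ge0 // invr_ge0 ltW.
  by rewrite exprS mulrA divfK ?gt_eqF.
exists (`|c| * K), x; split=> // n.
by rewrite fps_scaleC normrM -mulrA ler_wpM2l.
Qed.

Lemma geom_bounded_unshift f : geom_bounded f -> geom_bounded (unshift f).
Proof.
move=> [K [x [x0 h]]]; exists (K * x), x; split=> // n.
by rewrite -mulrA -exprS; exact: (h n.+1).
Qed.

Lemma geom_bounded_euler f : geom_bounded f -> geom_bounded (euler f).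
Proof.
move=> [K [x [x0 h]]]; exists K, (2 * x); split=> [|n]; first by rewrite mulr_gt0.
rewrite /euler normrM normr_nat exprMn mulrCA ler_pM //.
by rewrite -natrX ler_nat ltnW // ltn_expl.
Qed.

Lemma geom_bounded_twist w f : w != 0 -> geom_bounded f -> geom_bounded (twist w f).
Proof.
move=> w0 [K [x [x0 h]]]; exists K, (`|w| * x); split=> [|n].
  by rewrite mulr_gt0 // normr_gt0.
by rewrite /twist normrM normrX exprMn mulrCA ler_wpM2l.
Qed.

Lemma converges_geom_bounded f : converges_near0 f -> geom_bounded f.
Proof.
move=> /nbhs_ballP[e /= e0 he].
pose z : C := e / 2.
have z0 : 0 < z by rewrite divr_gt0.
have /he/cvg_series_cvg_0 : ball 0 e z.
  rewrite -ball_normE /= sub0r normrN gtr0_norm // /z ltr_pdivrMr //.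
  by rewrite ltr_pMr // ltr1n.
move=> /cvgr0Pnorm_lt/(_ 1 ltr01)[N _ hN].
exists (1 + \sum_(i < N) `|f i * z ^+ i|), z^-1; split; first by rewrite invr_gt0.
move=> n; rewrite exprVn ler_pdivlMr ?exprn_gt0 //.
rewrite -[z ^+ n]gtr0_norm ?exprn_gt0 // -normrM.
have [nN|Nn] := ltnP n N; last first.
  by rewrite (le_trans (ltW (hN n Nn))) // lerDl sumr_ge0.
rewrite (bigD1 (Ordinal nN)) //= addrCA lerDl addr_ge0 // sumr_ge0 //.
Qed.

End GeometricBound.

Section ComplexConvergence.
Variable R : realType.
Local Notation C := (R[i] : numFieldType).
Implicit Types (f : fps R[i]).

Lemma ler_norm_Re (z : R[i]) : `|complex.Re z|%:C <= `|z|.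
Proof.
by rewrite normc_def lecR -sqrtr_sqr ler_wsqrtr // lerDl sqr_ge0.
Qed.

Lemma ler_norm_Im (z : R[i]) : `|complex.Im z|%:C <= `|z|.
Proof.
by rewrite normc_def lecR -sqrtr_sqr ler_wsqrtr // lerDr sqr_ge0.
Qed.

Lemma norm_real_complex (x : R) : `|x%:C| = `|x|%:C.
Proof. by rewrite normc_def /= expr0n addr0 sqrtr_sqr. Qed.

Lemma cvg_real_complex (u : nat -> R) : cvgn u -> cvgn (fun n => (u n)%:C : C).
Proof.
move=> /cvg_ex[l /cvgrPdist_lt ul]; apply/cvg_ex; exists l%:C.
apply/cvgrPdist_lt => -[e e'] /=; rewrite ltcE /= => /andP[/eqP -> e0].
have := ul e e0; apply: filterS => n.
by rewrite -rmorphB norm_real_complex ltcR.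
Qed.

(** Real and imaginary parts converge by the completeness of [R]. *)
Lemma cvg_dominated_geometric (a : nat -> C) (K : R) :
  (forall n, `|a n| <= (K * 2^-1 ^+ n)%:C) -> cvgn (series a).
Proof.
move=> ha.
have cvg_part (b : nat -> R) : (forall n, `|b n|%:C <= `|a n|) -> cvgn (series b).
  move=> hb; apply: normed_cvg; apply: (@series_le_cvg R _ (geometric K 2^-1)) => //=.
  - move=> n; apply: le_trans (normr_ge0 (b n)) _.
    by rewrite -lecR (le_trans (hb n)) // ha.
  - by move=> n; rewrite -lecR (le_trans (hb n)) // ha.
  - apply: is_cvg_geometric_series.
    by rewrite gtr0_norm ?invr_gt0 // invf_lt1 // ltr1n.
have -> : series a = (fun n => (series (fun k => complex.Re (a k)) n)%:C
    + 'i%C * (series (fun k => complex.Im (a k)) n)%:C).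
  apply/funext => n; rewrite /series /= !rmorph_sum mulr_sumr -big_split.
  by apply: eq_bigr => k _; exact: complexE.
apply: is_cvgD; last apply: is_cvgMr.
  by apply: cvg_real_complex; apply: cvg_part => n; exact: ler_norm_Re.
by apply: cvg_real_complex; apply: cvg_part => n; exact: ler_norm_Im.
Qed.

Lemma converges_near0P f : converges_near0 f <-> geom_bounded f.
Proof.
split; first exact: converges_geom_bounded.
move=> [K [x [x0 h]]]; have K0 := geom_bounded_ge0 h.
have EK : K = (complex.Re K)%:C by rewrite RRe_real // ger0_real.
apply/nbhs_ballP; exists (2 * x)^-1 => /=; first by rewrite invr_gt0 mulr_gt0.
move=> z; rewrite -ball_normE /= sub0r normrN => zx.
apply: (@cvg_dominated_geometric _ (complex.Re K)) => n.
rewrite rmorphM /= -EK rmorphXn /= fmorphV /= rmorph_nat normrM normrX.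
apply: le_trans (ler_wpM2r (exprn_ge0 _ (normr_ge0 z)) (h n)) _.
rewrite -mulrA ler_wpM2l // -exprMn lerXn2r ?nnegrE ?invr_ge0 ?mulr_ge0 ?(ltW x0) //.
by rewrite mulrC -ler_pdivlMr // -invfM ltW.
Qed.

End ComplexConvergence.

(** * Closure properties of Mahler and of complete Hadamard functions *)

Section Complete.
Variables (R : realType) (k : nat).
Hypothesis k1 : (1 < k)%N.
Local Notation C := (R[i] : numFieldType).
Implicit Types (f g h : fps C) (p : {poly C}) (c w : C).

Lemma mahler_boundedP f : mahler k f <-> geom_bounded f /\ in_mahler_system k f.
Proof.
by split=> [/(mahlerP k1)|] [hf hs]; [split=> // | apply/(mahlerP k1); split=> //];
  apply/converges_near0P.
Qed.

Lemma mahler_add f g : mahler k f -> mahler k g -> mahler k (f + g : fps C).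
Proof.
move=> /mahler_boundedP[bf sf] /mahler_boundedP[bg sg]; apply/mahler_boundedP.
by split; [exact: geom_bounded_add | exact: in_mahler_system_add].
Qed.

Lemma mahler_scale p f : mahler k f -> mahler k (p *: f : fps C).
Proof.
move=> /mahler_boundedP[bf sf]; apply/mahler_boundedP.
by split; [exact: geom_bounded_scale | exact: in_mahler_system_scale].
Qed.

Lemma mahler_sum (I : Type) (s : seq I) (F : I -> fps C) :
  (forall i, mahler k (F i)) -> mahler k (\sum_(i <- s) F i : fps C).
Proof.
move=> hF; elim/big_rec: _ => [|i f _]; last exact: mahler_add.
apply/mahler_boundedP; split; last by exists void, (fun=> 0); split=> [[]|]; exact: inspan0.
by exists 0, 1; split=> // n; rewrite normr0 mul0r.
Qed.

Lemma mahler_one : mahler k (fps1 C).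
Proof.
apply/mahler_boundedP; split; last by apply: in_mahler_system_one.
exists 1, 1; split=> // n; rewrite expr1n mul1r /fps1 /fps_of_poly coef1.
by case: n => [|n]; rewrite ?normr1 // normr0.
Qed.

Lemma mahler_unshift f : mahler k f -> mahler k (unshift f).
Proof.
move=> /mahler_boundedP[bf sf]; apply/mahler_boundedP.
by split; [exact: geom_bounded_unshift | exact: in_mahler_system_unshift].
Qed.

Lemma mahler_euler f : mahler k f -> mahler k (euler f).
Proof.
move=> /mahler_boundedP[bf sf]; apply/mahler_boundedP.
by split; [exact: geom_bounded_euler | exact: in_mahler_system_euler].
Qed.

Lemma mahler_twist N w f : (0 < N)%N -> w ^+ N = 1 -> mahler k f -> mahler k (twist w f).
Proof.
move=> N0 wN /mahler_boundedP[bf sf]; apply/mahler_boundedP; split.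
  apply: geom_bounded_twist => //; apply/eqP => w0.
  by move/eqP: wN; rewrite w0 expr0n gtn_eqF // eq_sym oner_eq0.
exact: (in_mahler_system_twist N0 wN sf).
Qed.

Lemma complete_hadamard_add f g :
  complete_hadamard k f -> complete_hadamard k g -> complete_hadamard k (f + g : fps C).
Proof.
move=> hf hg h mh; rewrite (_ : hadamard _ h = (hadamard f h : fps C) + hadamard g h).
  by apply: mahler_add; [exact: hf | exact: hg].
by apply/funext => n; exact: mulrDl.
Qed.

(** For [p = 'X] the Hadamard product of [q f] with [h] is [q] times that of [f]
    with [(h - h(0)) / q]. *)
Lemma complete_hadamard_scale p f :
  complete_hadamard k f -> complete_hadamard k (p *: f : fps C).
Proof.
elim/poly_ind: p f => [|p c IH] f hf.
  rewrite scale0r => h mh; rewrite (_ : hadamard _ h = 0 *: (h : fps C)).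
    exact: mahler_scale.
  by rewrite scale0r; apply/funext => n; exact: mul0r.
rewrite scalerDl -scalerA; apply: complete_hadamard_add.
  apply: IH => h mh.
  rewrite (_ : hadamard _ h = 'X *: (hadamard f (unshift h) : fps C)).
    by apply/mahler_scale/hf/mahler_unshift.
  apply/funext => -[|n]; rewrite /hadamard !fps_scaleX //=.
  exact: mul0r.
move=> h mh; rewrite (_ : hadamard _ h = c%:P *: (hadamard f h : fps C)).
  by apply/mahler_scale/hf.
by apply/funext => n; rewrite /hadamard !fps_scaleC mulrA.
Qed.

Lemma complete_hadamard_poly p : complete_hadamard k (p *: fps1 C).
Proof.
apply: complete_hadamard_scale => h _.
rewrite (_ : hadamard _ h = (h 0%N)%:P *: fps1 C); first exact/mahler_scale/mahler_one.
apply/funext => -[|n]; rewrite /hadamard fps_scaleC /fps1 /fps_of_poly coef1 /=.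
  exact: mulrC.
by rewrite mul0r mulr0.
Qed.

End Complete.

(** * Inverse powers of [1 - q^N] *)

Section Cyclotomic.
Variable C : numFieldType.
Implicit Types (f g : fps C) (p : {poly C}).

Lemma fps_scale_inj p f g : p`_0 != 0 -> p *: f = p *: g -> f = g.
Proof.
move=> p0 E; apply/funext; elim/ltn_ind => n IH.
have /(congr1 (fun h : fps C => h n)) := E.
rewrite !fps_scaleE /fps_mul !big_ord_recl subn0 => En.
apply: (mulfI p0); move: En; rewrite (eq_bigr (fun i : 'I_n =>
  fps_of_poly p (lift ord0 i) * g (n - lift ord0 i)%N)); first exact: addIr.
move=> i _; rewrite IH // /= /bump leq0n add1n.
by rewrite ltn_subrL (leq_ltn_trans _ (ltn_ord i)).
Qed.

Variable N : nat.
Hypothesis N0 : (0 < N)%N.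

(** The expansion of [(1 - q^N)^-(M+1)], in a form that makes Hadamard products
    with it easy to compute; see [inv_cyclotomic_powP]. *)
Fixpoint inv_cyclotomic_pow (M : nat) : fps C :=
  if M is M'.+1 then
    inv_cyclotomic_pow M'
      + ((M * N)%:R^-1)%:P *: euler (inv_cyclotomic_pow M')
  else fun n => (N %| n)%:R.

(** In the induction step, applying [q d/dq] to the induction hypothesis
    evaluates the product of [(1 - q^N)^(M+1)] with the derivative term. *)
Lemma inv_cyclotomic_powP M : ((1 - 'X^N) ^+ M.+1) *: inv_cyclotomic_pow M = fps1 C.
Proof.
elim: M => [|M IH].
  rewrite expr1 scalerBl scale1r; apply/funext => n.
  rewrite fps_addE fps_oppE fps_scaleXn /fps1 /fps_of_poly coef1 /=.
  case: leqP => [Nn|nN].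
    have -> : (N %| n - N)%N = (N %| n)%N by rewrite -[in RHS](subnK Nn) dvdn_addl.
    by rewrite subrr gtn_eqF // (leq_trans N0).
  rewrite subr0; case: n nN => [|n] nN; first by rewrite dvdn0.
  by rewrite gtnNdvd.
pose u : {poly C} := 1 - 'X^N.
have /(congr1 (@euler C)) := IH; rewrite eulerZ -/u.
have -> : euler (fps1 C) = 0.
  apply/funext => n; rewrite /euler /fps1 /fps_of_poly coef1.
  by case: n => [|n]; [exact: mul0r | exact: mulr0].
have -> : 'X * (u ^+ M.+1)^`() = - ((M.+1 * N)%:R%:P * 'X^N * u ^+ M).
  have -> : (M.+1 * N)%:R%:P = M.+1%:R * N%:R :> {poly C}.
    by rewrite natrM polyCM !polyC_natr.
  rewrite deriv_exp {1}/u derivB derivXn derivC sub0r /=.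
  rewrite -[_ *+ M.+1]mulr_natl -['X^(N.-1) *+ N]mulr_natl.
  have -> : 'X^N = 'X * 'X^(N.-1) :> {poly C} by rewrite -exprS prednK.
  move: (M.+1%:R : {poly C}) (N%:R : {poly C}) ('X^(N.-1) : {poly C}) (u ^+ M) => a b c d.
  by ring.
rewrite scaleNr => /eqP; rewrite addrC subr_eq0 => /eqP E.
have Mn0 : (M.+1 * N)%:R != 0 :> C by rewrite pnatr_eq0 muln_eq0 negb_or -!lt0n N0.
rewrite /= scalerDr exprS -[X in X + _]scalerA IH -/u scalerA mulrAC -scalerA E scalerA.
have -> : u * (M.+1 * N)%:R^-1%:P * ((M.+1 * N)%:R%:P * 'X^N * u ^+ M) =
    ((M.+1 * N)%:R^-1 * (M.+1 * N)%:R)%:P * ('X^N * u ^+ M.+1).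
  by rewrite polyCM exprS; ring.
by rewrite mulVf // mul1r -scalerA IH -scalerDl /u subrK scale1r.
Qed.

End Cyclotomic.

(** * Sufficiency *)

Section RootsOfUnity.
Variables (R : realType) (k : nat).
Hypothesis k1 : (1 < k)%N.
Local Notation C := (R[i] : numFieldType).
Implicit Types (f g : fps C) (p s : {poly C}) (w z : C).

Lemma prim_root_exists N : (0 < N)%N -> exists w : R[i], N.-primitive_root w.
Proof.
move=> N0; pose p : {poly R[i]} := 'X^N - 1; have [r Dp] := closed_field_poly_normal p.
rewrite (monicP _) ?monicXnsubC // scale1r in Dp.
have rN : all N.-unity_root r by apply/allP=> z; rewrite -root_prod_XsubC -Dp.
have sz_r : (N < (size r).+1)%N by rewrite -(size_prod_XsubC r id) -Dp size_XnsubC.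
have [|w] := hasP (has_prim_root N0 rN _ sz_r); last by exists w.
by rewrite -separable_prod_XsubC -Dp separable_Xn_sub_1 // pnatr_eq0 -lt0n.
Qed.

Lemma sum_prim_root N (w : C) n : N.-primitive_root w ->
  \sum_(t < N) (w ^+ t) ^+ n = if (N %| n)%N then N%:R else 0.
Proof.
move=> pw; have -> : \sum_(t < N) (w ^+ t) ^+ n = \sum_(t < N) (w ^+ n) ^+ t.
  by apply: eq_bigr => t _; rewrite exprAC.
case: ifPn => Nn.
  have -> : w ^+ n = 1 by apply/eqP; rewrite -(prim_order_dvd pw).
  rewrite (eq_bigr (fun=> 1)) => [|t _]; last by rewrite expr1n.
  by rewrite sumr_const card_ord.
have wn1 : w ^+ n - 1 != 0 by rewrite subr_eq0 -(prim_order_dvd pw).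
by apply: (mulfI wn1); rewrite -subrX1 exprAC (prim_expr_order pw) expr1n subrr mulr0.
Qed.

(** The recursion defining [inv_cyclotomic_pow] moves [euler] to the other
    factor; the base case filters the multiples of [N] by averaging twists. *)
Lemma complete_hadamard_inv_cyclotomic N M :
  (0 < N)%N -> complete_hadamard k (inv_cyclotomic_pow C N M).
Proof.
move=> N0; elim: M => [|M IH] g mg /=.
  have [w pw] := prim_root_exists N0.
  rewrite (_ : hadamard _ g = (N%:R^-1)%:P *: \sum_(t < N) twist (w ^+ t : C) (g : fps C)).
    apply: (mahler_scale k1); apply: (mahler_sum k1) => t.
    by apply: (mahler_twist k1 N0 _ mg); rewrite exprAC (prim_expr_order pw) expr1n.
  apply/funext => n; rewrite fps_scaleC fps_sumE /twist -mulr_suml (sum_prim_root _ pw).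
  rewrite /hadamard mulrA; congr (_ * _); case: ifP => _; last by rewrite mulr0.
  by rewrite mulVf // pnatr_eq0 -lt0n.
set c : C := _^-1.
rewrite (_ : hadamard _ g =
    hadamard (inv_cyclotomic_pow C N M) ((g : fps C) + c%:P *: euler (g : fps C))).
  by apply: IH; apply: (mahler_add k1) => //; apply: (mahler_scale k1); exact: mahler_euler.
apply/funext => n; rewrite /hadamard !fps_addE !fps_scaleC /euler.
by move: (inv_cyclotomic_pow C N M n) (g n) (n%:R : C) => a b d; ring.
Qed.

Lemma dvd_cyclotomic_pow s : s != 0 ->
    (forall z, root s z -> exists2 n : nat, (0 < n)%N & z ^+ n = 1) ->
  exists N M, (0 < N)%N /\ s %| (1 - 'X^N) ^+ M.
Proof.
move=> s0 hs; have [r Ds] := closed_field_poly_normal (s : {poly R[i]}).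
have {}hs z : z \in r -> exists2 n : nat, (0 < n)%N & z ^+ n = 1.
  move=> zr; apply: hs; rewrite Ds rootZ ?lead_coef_eq0 //.
  by rewrite root_prod_XsubC.
have [N N0 hN] : exists2 N, (0 < N)%N & forall z, z \in r -> z ^+ N = 1.
  elim: r {Ds} hs => [|z r IH] hs; first by exists 1%N.
  have [|N N0 hN] := IH; first by move=> y yr; apply: hs; rewrite inE yr orbT.
  have [n n0 zn] := hs z (mem_head _ _).
  exists (n * N)%N; first by rewrite muln_gt0 n0.
  move=> y; rewrite inE => /orP[/eqP ->|yr]; first by rewrite exprM zn expr1n.
  by rewrite mulnC exprM hN // expr1n.
exists N, (size r); split=> //; rewrite Ds dvdpZl ?lead_coef_eq0 //.
elim: r {Ds hs} hN => [|z r IH] hN; first by rewrite big_nil dvd1p.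
rewrite big_cons exprS dvdp_mul //; last by apply: IH => y yr; apply: hN; rewrite inE yr orbT.
by rewrite dvdp_XsubCl /root !hornerE hN ?mem_head // subrr.
Qed.

Lemma complete_hadamard_of_unity_roots s p f : s != 0 -> s *: f = p *: fps1 C ->
    (forall z, root s z -> exists2 n : nat, (0 < n)%N & z ^+ n = 1) ->
  complete_hadamard k f.
Proof.
move=> s0 E /(dvd_cyclotomic_pow s0)[N [M [N0 /dvdpP[v Dv]]]].
suff -> : f = ((1 - 'X^N) * v * p) *: inv_cyclotomic_pow C N M.
  exact/complete_hadamard_scale/complete_hadamard_inv_cyclotomic.
apply: (@fps_scale_inj _ ((1 - 'X^N) ^+ M.+1)).
  by rewrite -horner_coef0 !hornerE expr0n gtn_eqF //= subr0 expr1n oner_eq0.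
rewrite scalerA mulrC -scalerA inv_cyclotomic_powP // exprS Dv.
by rewrite mulrA -scalerA E scalerA.
Qed.

End RootsOfUnity.

(** * The sum of the q^(k^n) *)

Section PowersOfk.
Variables (C : numFieldType) (k : nat).
Hypothesis k1 : (1 < k)%N.
Let k0 : (0 < k)%N. Proof. exact: ltnW. Qed.

(** [trunc_log k n] is the only candidate exponent; at [n = 0] it is [0], and the
    coefficient is [0] as it should be. *)
Definition fps_powers : fps C := fun n => (n == k ^ trunc_log k n)%N%:R.

Lemma fps_powers_exp m : fps_powers (k ^ m)%N = 1.
Proof. by rewrite /fps_powers trunc_expnK // eqxx. Qed.

Lemma fps_powers_eq0 n : (forall m, n != k ^ m)%N -> fps_powers n = 0.
Proof. by move=> /(_ (trunc_log k n))/negPf h; rewrite /fps_powers h. Qed.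

Lemma fps_powersE : fps_powers = 'X *: fps1 C + dilate k fps_powers.
Proof.
apply/funext => n; rewrite fps_addE fps_scale_one coefX dilateE.
have [/existsP[[m _] /= /eqP ->]|/existsPn h] :=
    boolP [exists m : 'I_n.+1, n == (k ^ m)%N].
  rewrite fps_powers_exp; case: m => [|m].
    by rewrite expn0 eqxx dvdn1 gtn_eqF // addr0.
  rewrite expnS dvdn_mulr // mulKn // fps_powers_exp gtn_eqF ?add0r //.
  by rewrite (leq_trans k1) // leq_pmulr // expn_gt0 k0.
have {}h m : n != (k ^ m)%N.
  apply/eqP => E; have mn : (m < n.+1)%N by rewrite E ltnS ltnW // ltn_expl.
  by have := h (Ordinal mn); rewrite /= {1}E eqxx.
rewrite (fps_powers_eq0 h).
have /negPf -> : n != 1%N by have := h 0%N; rewrite expn0.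
rewrite add0r; case: ifP => // kn; rewrite fps_powers_eq0 // => m.
by apply: contra (h m.+1) => /eqP E; rewrite expnS -E mulnC divnK.
Qed.

Lemma in_mahler_system_powers : in_mahler_system k fps_powers.
Proof.
pose H (b : bool) := if b then fps_powers else fps1 C.
exists bool, H; split; last exact: (inspan_mem H true).
move=> [] /=.
  rewrite {1}fps_powersE; apply: inspanD; last exact: (inspan_mem (fun b => dilate k (H b)) true).
  apply: inspanZ; rewrite -(dilate_fps1 C k0).
  exact: (inspan_mem (fun b => dilate k (H b)) false).
rewrite -{1}(dilate_fps1 C k0).
exact: (inspan_mem (fun b => dilate k (H b)) false).
Qed.

Lemma geom_bounded_powers : geom_bounded fps_powers.
Proof.
exists 1, 1; split=> // n; rewrite expr1n mul1r /fps_powers.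
by case: (n == _); rewrite ?normr1 // normr0.
Qed.

(** Powers of [k] are so sparse that a bounded perturbation does not lead from a
    large one to another. *)
Lemma expn_add_inj S m t a b : (S <= m)%N -> (a <= S)%N -> (b <= S)%N ->
  (k ^ m.+1 + a = k ^ t + b)%N -> t = m.+1.
Proof.
move=> Sm aS bS E; have Sk : (S < k ^ m)%N by rewrite (leq_ltn_trans Sm) // ltn_expl.
have km : (k ^ m + k ^ m <= k ^ m.+1)%N by rewrite expnS addnn -mul2n leq_mul2r k1 orbT.
have [tm|mt|//] := ltngtP t m.+1.
  have : (k ^ t <= k ^ m)%N by rewrite leq_exp2l.
  by lia.
have : (k ^ m.+2 <= k ^ t)%N by rewrite leq_exp2l.
have : (k ^ m.+1 + k ^ m.+1 <= k ^ m.+2)%N.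
  by rewrite [in X in (_ <= X)%N]expnS addnn -mul2n leq_mul2r k1 orbT.
by lia.
Qed.

(** [j] is the degree of [B 0], [S] bounds all sizes in the equation, and the
    coefficient of [q^(k^(t+d) + j)] says that [w ^+ (k ^ t)] is a root of [Q]. *)
Lemma twist_powers_unity (w : C) : w != 0 -> mahler k (twist w fps_powers) ->
  exists2 N : nat, (0 < N)%N & w ^+ N = 1.
Proof.
move=> w0 [_ [d [A [B [B0d E]]]]].
set u := twist w fps_powers in E.
have B0 : B 0%N != 0 by move: B0d; rewrite mulf_eq0 negb_or => /andP[].
pose j := (size (B 0%N)).-1.
have Bj : (B 0%N)`_j != 0 by rewrite -lead_coefE lead_coef_eq0.
pose S := (size A + \sum_(i < d.+1) size (B i))%N.
have sB (i : 'I_d.+1) : (size (B i) <= S)%N.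
  by rewrite /S (bigD1 i) //= addnCA leq_addr.
have jS : (j <= S)%N by apply: leq_trans (leq_pred _) (sB ord0).
have uk m : u (k ^ m)%N = w ^+ (k ^ m) by rewrite /u /twist fps_powers_exp mulr1.
have u0 n : (forall m, n != k ^ m)%N -> u n = 0.
  by move=> h; rewrite /u /twist fps_powers_eq0 // mulr0.
pose Q : {poly C} := \sum_(i < d.+1) (B i)`_j *: 'X^(k ^ (d - i)).
have Q0 : Q != 0.
  (* The exponents [k ^ (d - i)] are distinct, so the [i = 0] term survives. *)
  apply/eqP => /(congr1 (fun q : {poly C} => q`_(k ^ d))); rewrite coef0 coef_sum big_ord_recl.
  rewrite big1 => [|i _]; rewrite coefZ coefXn.
    by rewrite subn0 eqxx mulr1 addr0; apply/eqP.
  by rewrite eqn_exp2l // eq_sym ltn_eqF ?mulr0 // /= /bump; have := ltn_ord i; lia.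
have rootQ t : (S < t)%N -> root Q (w ^+ (k ^ t)).
  move=> St; pose m := (t + d).-1; have Em : (t + d = m.+1)%N by rewrite /m; lia.
  have Sm : (S <= m)%N by lia.
  have coefB (i : 'I_d.+1) : fps_mul (fps_of_poly (B i)) (dilate (k ^ i) u) (k ^ m.+1 + j)%N
      = (B i)`_j * w ^+ (k ^ (m.+1 - i)).
    have jk : (j < (k ^ m.+1 + j).+1)%N by rewrite ltnS leq_addl.
    have im : (i <= m.+1)%N by have := ltn_ord i; lia.
    rewrite /fps_mul (bigD1 (Ordinal jk)) //= big1 ?addr0 => [|[l lk] /eqP lj].
      rewrite addnK dilateE -{1 2}(subnKC im) expnD dvdn_mulr // mulKn ?expn_gt0 ?k0 //.
      by rewrite uk.
    (* Only the term [l = j] survives: otherwise [B i] has no coefficient at [l], or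
       [k ^ m.+1 + j - l] would be another power of [k]. *)
    have [lS|Sl] := leqP (size (B i)) l.
      by rewrite /fps_of_poly /= nth_default ?mul0r.
    rewrite dilateE; case: ifP => [/dvdnP[x Ex]|]; last by rewrite mulr0.
    rewrite /= Ex mulnK ?expn_gt0 ?k0 // u0 ?mulr0 // => v; apply/eqP => Ev.
    have lk' : (l <= k ^ m.+1 + j)%N by rewrite -ltnS.
    move: Ex; rewrite /= Ev -expnD => Ex.
    have lS : (l <= S)%N by have := sB i; lia.
    have E2 : (k ^ m.+1 + j = k ^ (v + i) + l)%N by rewrite -Ex subnK.
    have E3 := expn_add_inj Sm jS lS E2.
    by apply: lj; apply: val_inj => /=; move: E2; rewrite E3 => /addnI ->.
  have := E (k ^ m.+1 + j)%N.
  rewrite {1}/fps_of_poly nth_default ?add0r; last first.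
    apply: leq_trans (leq_addr j _); apply: leq_trans (leq_trans (leq_addr _ _) Sm) _.
    by rewrite ltnW // (ltn_trans (ltnSn m)) // ltn_expl.
  rewrite (eq_bigr _ (fun i _ => coefB i)) => E'.
  rewrite /root /Q horner_sum -[X in _ == X]E'; apply/eqP/eq_bigr => i _.
  rewrite !hornerE -exprM -expnD; congr (_ * _ ^+ (k ^ _)).
  by have := ltn_ord i; lia.
(* [size Q] consecutive roots cannot be distinct. *)
pose xs := [seq w ^+ (k ^ (S.+1 + t)) | t <- iota 0 (size Q)].
have : ~~ uniq xs.
  apply/negP => /(max_poly_roots Q0); rewrite size_map size_iota ltnn.
  suff -> : all (root Q) xs by move/(_ isT).
  by apply/allP => _ /mapP[t _ ->]; apply: rootQ; rewrite leq_addr.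
move=> /(uniqPn 0)[a [b [ab]]]; rewrite size_map size_iota => bQ.
rewrite !(nth_map 0%N) ?size_iota // ?(ltn_trans ab) // !nth_iota // ?(ltn_trans ab) // !add0n => Ew.
have kab : (k ^ (S.+1 + a) < k ^ (S.+1 + b))%N by rewrite ltn_exp2l // ltn_add2l.
exists (k ^ (S.+1 + b) - k ^ (S.+1 + a))%N; first by rewrite subn_gt0.
have wa : w ^+ (k ^ (S.+1 + a)) != 0 by rewrite expf_neq0.
by apply: (mulfI wa); rewrite mulr1 -exprD subnKC ?(ltnW kab).
Qed.

End PowersOfk.

(** * Necessity *)

Section Necessity.
Variables (R : realType) (k : nat).
Hypothesis k1 : (1 < k)%N.
Local Notation C := (R[i] : numFieldType).
Implicit Types (f g : fps C) (p s : {poly C}) (z : C).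

(** A combination of [f] with polynomial coefficients and a polynomial isolates
    the pole at [z]; coprimality makes the residue [p.[z]] nonzero. *)
Lemma complete_hadamard_pole s p f z : coprimep p s -> z != 0 -> root s z ->
    s *: f = p *: fps1 C -> complete_hadamard k f ->
  complete_hadamard k ((fun n => z^-1 ^+ n) : fps C).
Proof.
move=> cps z0 sz E cf.
have /factor_theorem[s' Ds] := sz.
have pz : p.[z] != 0.
  have : coprimep p ('X - z%:P) by apply: (@coprimep_dvdl _ _ _ _ _ cps); rewrite dvdp_XsubCl.
  by rewrite coprimep_XsubC.
have /factor_theorem[p' Dp] : root (p - p.[z]%:P) z by rewrite /root !hornerE subrr.
have {}Dp : p = p' * ('X - z%:P) + p.[z]%:P by rewrite -Dp subrK.
pose h := s' *: f - p' *: fps1 C.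
have ch : complete_hadamard k h.
  apply: (complete_hadamard_add k1); first exact: (complete_hadamard_scale k1).
  by rewrite -scaleNr; exact: (complete_hadamard_poly k1).
have hE : ('X - z%:P) *: h = p.[z]%:P *: fps1 C.
  rewrite /h scalerBr !scalerA ![('X - _) * _]mulrC -Ds E {1}Dp scalerDl.
  by rewrite addrC addrA [X in X + _]addrC subrr add0r.
suff -> : (fun n => z^-1 ^+ n) = (- z / p.[z])%:P *: h.
  exact: (complete_hadamard_scale k1).
apply: (@fps_scale_inj _ ('X - z%:P)).
  by rewrite coefB coefX coefC sub0r oppr_eq0.
rewrite scalerA mulrC -scalerA hE scalerA -polyCM divfK //.
apply/funext => n; rewrite scalerBl fps_addE fps_oppE fps_scaleX !fps_scaleC.
rewrite /fps1 /fps_of_poly coef1; case: n => [|n]; first by rewrite sub0r mulNr.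
by rewrite exprS mulrA mulfV // mul1r subrr mulr0.
Qed.

End Necessity.

(** * The equivalence *)

Theorem theorem3p2p2 (R : realType) (k : nat) (hk : (2 <= k)%N)
    (r s : {poly R[i]}) (hrs : coprimep r s) (hs0 : s.[0] != 0)
    (f : nat -> R[i]) (hf : expansion_of r s f) :
  complete_hadamard k f <->
  (forall z : R[i], root s z -> exists2 n : nat, (0 < n)%N & n.-unity_root z).
Proof.
have hE : s *: (f : fps R[i]) = r *: fps1 R[i].
  by apply/funext => n; rewrite fps_scale_one; exact: hf.
split=> [cf z sz | hs].
  have z0 : z != 0 by apply: contraTneq sz => ->.
  have mg : mahler k (fps_powers R[i] k).
    apply/(mahler_boundedP hk); split; first exact: geom_bounded_powers.
    exact: in_mahler_system_powers.
  have ch := complete_hadamard_pole hk hrs z0 sz hE cf.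
  have [|N N0 zN] := twist_powers_unity hk _ (ch _ mg); first by rewrite invr_eq0.
  by exists N => //; apply/unity_rootP; apply: invr_inj; rewrite -exprVn zN invr1.
have s0 : s != 0 by apply: contraNneq hs0 => ->; rewrite horner0.
apply: (complete_hadamard_of_unity_roots hk s0 hE) => z /hs[n n0 zn].
by exists n => //; apply/unity_rootP.
Qed.
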